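(* Let $p,q$ be positive integers. If $q\geq 2p$, then Breaker has a winning strategy for the $(p,q)$-percolation game on $\mathbb{Z}^2$.
   Context: The $(p,q)$-percolation game on $(\Lambda,v_0)$, where $\Lambda$ is an infinite connected (multi)graph, $v_0$ is a vertex of $\Lambda$ and $p,q$ are positive integers: two players, Maker and Breaker, play in alternating turns, with Maker playing first. Initially all edges of $\Lambda$ are marked as unsafe. On each of her turns, Maker marks $p$ unsafe edges as safe; on each of his turns, Breaker takes $q$ unsafe edges and deletes them from the graph. Breaker wins if at any time in the game the component containing $v_0$ (in the graph of edges not deleted) becomes finite. If Maker is able to ensure that $v_0$ remains in an infinite component indefinitely, then she is said to have a winning strategy. If $\Lambda$ is vertex-transitive, the choice of $v_0$ does not matter and one speaks of the $(p,q)$-percolation game on $\Lambda$. The graph $\mathbb{Z}^2$ has vertex set $\mathbb{Z}^2$, with two vertices joined by an edge if and only if they lie at Euclidean distance $1$ from each other. *)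

(* Defs.v *)
From HB Require Import structures.
From Stdlib Require Import Relation_Operators.
From mathcomp Require Import all_boot all_order all_algebra finmap.
From mathcomp Require Import ring.
From mathcomp Require Import boolp classical_sets functions cardinality.

Set Implicit Arguments.
Unset Strict Implicit.
Unset Printing Implicit Defensive.

Import Order.TTheory GRing.Theory Num.Theory.

Local Open Scope fset_scope.

(* A loop at [u] is an edge with [ends e = [fset u]], which is [[fset u; u]]. *)
Record multigraph := Multigraph {
  vertex : choiceType;
  edge : choiceType;
  ends : edge -> {fset vertex};
  endsP : forall e, exists u v, ends e = [fset u; v] }.

Section Game.
Variable G : multigraph.
Implicit Types (D m b : {fset edge G}) (u v : vertex G).

Definition adjacent D u v : Prop :=
  exists2 e : edge G, e \notin D & ends e = [fset u; v].

Definition component D v : set (vertex G) :=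
  [set u | clos_refl_trans (vertex G) (adjacent D) v u]%classic.

Definition infinite_connected : Prop :=
  infinite_set [set: vertex G]%classic /\
  forall v, component fset0 v = [set: vertex G]%classic.

(* The completed rounds, oldest first: the edges marked safe by Maker, then
   the edges deleted by Breaker. *)
Definition history := seq ({fset edge G} * {fset edge G}).
Implicit Type h : history.

Definition safe h : {fset edge G} := \bigcup_(r <- h) r.1.
Definition deleted h : {fset edge G} := \bigcup_(r <- h) r.2.

Definition maker_legal (p : nat) h m : Prop :=
  #|` m| = p /\ [disjoint m & safe h `|` deleted h].

(* Breaker answers [m], whose edges are already safe. *)
Definition breaker_legal (q : nat) h m b : Prop :=
  #|` b| = q /\ [disjoint b & (safe h `|` m) `|` deleted h].

Definition strategy := history -> {fset edge G} -> {fset edge G}.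

Definition rounds (M B : nat -> {fset edge G}) (n : nat) : history :=
  mkseq (fun i => (M i, B i)) n.

(* Plays are continued for ever, even once Breaker has won: in an infinite
   connected graph neither player runs out of unsafe edges, and a finite
   component stays finite. *)
Definition winning_for_breaker (p q : nat) v0 (sigma : strategy) : Prop :=
  forall M B : nat -> {fset edge G},
    (forall n, maker_legal p (rounds M B n) (M n)) ->
    (forall n, B n = sigma (rounds M B n) (M n)) ->
    (forall n, breaker_legal q (rounds M B n) (M n) (B n)) /\
    exists n, finite_set (component (deleted (rounds M B n)) v0).

Definition breaker_has_winning_strategy (p q : nat) v0 : Prop :=
  exists sigma : strategy, winning_for_breaker p q v0 sigma.

End Game.

Section SquareLattice.
Local Open Scope ring_scope.

Definition sqdist (u v : int * int) : int :=
  (u.1 - v.1) ^+ 2 + (u.2 - v.2) ^+ 2.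

Definition is_Z2_edge (e : {fset int * int}) : bool :=
  `[< exists u v, sqdist u v = 1 /\ e = [fset u; v] >].

Lemma Z2_endsP (e : {e : {fset int * int} | is_Z2_edge e}) :
  exists u v, val e = [fset u; v].
Proof. by case: e => e /= /asboolP[u [v [_ ->]]]; exists u, v. Qed.

Definition Z2 : multigraph := Multigraph Z2_endsP.

Lemma Z2_adjacent (u v : int * int) :
  adjacent fset0 (u : vertex Z2) v <-> sqdist u v = 1.
Proof.
split=> [[[e he] _ /=]|uv]; last first.
  have h : is_Z2_edge [fset u; v] by apply/asboolP; exists u, v.
  by exists (Sub _ h : edge Z2); rewrite ?inE ?SubK.
move: (he) => /asboolP[x [y [xy ->]]] E.
have nxx z : sqdist z z <> 1 by rewrite /sqdist !subrr.
have yx : sqdist y x = 1.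
  by rewrite -xy /sqdist -(opprB x.1) -(opprB x.2) !sqrrN.
have: u \in [fset x; y] by rewrite E !inE eqxx.
have: v \in [fset x; y] by rewrite E !inE eqxx orbT.
rewrite !inE => /orP[] /eqP ev /orP[] /eqP eu; subst => //.
- have: y \in [fset x; x] by rewrite -E !inE eqxx orbT.
  by rewrite !inE orbb => /eqP yx'; rewrite yx' in xy.
- have: x \in [fset y; y] by rewrite -E !inE eqxx.
  by rewrite !inE orbb => /eqP yx'; rewrite yx' in xy.
Qed.

Lemma Z2_infinite_connected : infinite_connected Z2.
Proof.
split=> [fin|v].
  apply: infinite_nat.
  suff <- : ((fun u : int * int => `|u.1|%N) @` [set: vertex Z2])%classic = setT.
    exact: finite_image.
  by apply/seteqP; split=> // n _; exists (n%:Z, 0).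
have step (u w : int * int) : sqdist u w = 1 ->
    component fset0 (v : vertex Z2) u -> component fset0 (v : vertex Z2) w.
  by move=> uw vu; apply: rt_trans vu _; apply: rt_step; apply/Z2_adjacent.
have hor (k x y : int) : component fset0 (v : vertex Z2) (x, y) ->
    component fset0 (v : vertex Z2) (x + k, y).
  move=> vxy; elim: k => [|n IH|n IH]; first by rewrite addr0.
  - by apply: step IH; rewrite /sqdist /=; ring.
  - by apply: step IH; rewrite /sqdist /=; ring.
have ver (k x y : int) : component fset0 (v : vertex Z2) (x, y) ->
    component fset0 (v : vertex Z2) (x, y + k).
  move=> vxy; elim: k => [|n IH|n IH]; first by rewrite addr0.
  - by apply: step IH; rewrite /sqdist /=; ring.
  - by apply: step IH; rewrite /sqdist /=; ring.
apply/seteqP; split=> // -[x y] _; case: v step hor ver => a b _ hor ver.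
rewrite -(subrKC a x) -(subrKC b y).
by apply/ver/hor; apply: rt_refl.
Qed.

End SquareLattice.

(* Main.v *)
(** Let [C] be the component of [v0] in the graph of safe edges, of size [n],
and call an edge leaving [C] free if it is not deleted. Breaker deletes only
free edges, all of them as soon as at most [q] are left, which encloses [C].

Counting edges at [C] after [t] rounds, with [n <= p t + 1]:
  #free + #(edges inside C) + q t <= 3 n + 1.
As long as some edge is free, this yields [p t <= n <= p t + 1]; so Maker can
waste at most one edge in the whole game, [C] grows in every two rounds, it
spans at most three independent cycles and has at most four free edges after
Breaker's turn.

A free edge is bad (for Maker) if its outer end has two neighbours in [C]:
using it closes a cycle. It is fair if it is bad, or touches [v0], or makes a
turn: its ends [t] in [C] and [w] and some [s] in [C] lie on a unit square with
fourth corner [z]. The only unfair edge at a vertex prolongs the edge by which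
that vertex was reached, so one round creates at most [p + 1 <= q] of them, and
by deleting unfair edges first and bad edges last Breaker leaves fair edges
only. If Maker then uses a fair edge that is neither bad nor at [v0], either
[z] is reached and a cycle is closed, or [wz] becomes a new bad edge, which
Breaker keeps. Cycles, neighbours of [v0] in [C] and bad free edges are bounded
in number, so this cannot go on for ever. *)

From Stdlib Require Import Relation_Operators Operators_Properties.
Require Import Defs.
From mathcomp Require Import all_boot all_order all_algebra finmap zify.
From mathcomp Require Import ring.
From mathcomp Require Import boolp classical_sets cardinality.

Set Implicit Arguments.
Unset Strict Implicit.
Unset Printing Implicit Defensive.

Import GRing.Theory.

Local Open Scope fset_scope.
Local Open Scope nat_scope.

Lemma ltn_card_fset (T : choiceType) (A B : {fset T}) x :
  A `<=` B -> x \in B -> x \notin A -> #|` A| < #|` B|.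
Proof.
move=> AB xB xA; apply: fproper_ltn_card; rewrite fproperE AB.
by apply: contra xA => /fsubsetP; apply.
Qed.

(** * The square lattice: adjacency, edges and stars *)

Local Notation V := (vertex Z2).
Local Notation E := (edge Z2).

Definition adj (u v : int * int) : bool := sqdist u v == 1%R.

Lemma adj_sym u v : adj u v = adj v u.
Proof. by rewrite /adj /sqdist; congr (_ == _); ring. Qed.

Lemma adjxx u : adj u u = false.
Proof. by rewrite /adj /sqdist !subrr. Qed.

Lemma adj_edge (u v : V) : adj u v -> exists e : E, val e = [fset u; v].
Proof.
move=> uv; have h : is_Z2_edge [fset u; v].
  by apply/asboolP; exists u, v; split=> //; apply/eqP.
by exists (Sub _ h : E); rewrite SubK.
Qed.

Lemma edge_other (e : E) (v : V) : v \in val e ->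
  exists2 u : V, adj v u & val e = [fset v; u].
Proof.
move: (valP e) => /asboolP[a [b [/eqP ab ->]]]; rewrite !inE => /orP[]/eqP->.
  by exists b.
by exists a; [rewrite adj_sym | rewrite fsetUC].
Qed.

Lemma edge_adj (e : E) (u v : V) : val e = [fset u; v] -> adj u v.
Proof.
move=> ve; have : u \in val e by rewrite ve !inE eqxx.
case/edge_other=> w uw; rewrite ve => /fsetP eqs.
have := eqs w; rewrite !inE eqxx orbT; case: (eqVneq w u) => [wu _|_ /eqP<-//].
by rewrite wu adjxx in uw.
Qed.

Lemma edge_endl (e : E) (u v : V) : val e = [fset u; v] -> u \in val e.
Proof. by move->; rewrite !inE eqxx. Qed.

Lemma edge_endr (e : E) (u v : V) : val e = [fset u; v] -> v \in val e.
Proof. by move->; rewrite !inE eqxx orbT. Qed.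

Definition steps : seq (int * int) := [:: (1, 0); (-1, 0); (0, 1); (0, -1)]%R.

Definition star (v : V) : {fset E} :=
  [fset e in pmap insub [seq [fset v; (v.1 + d.1, v.2 + d.2)%R] | d <- steps]].

Lemma card_star v : #|` star v| <= 4.
Proof.
rewrite card_fseq (leq_trans (size_undup _))// size_pmap.
by rewrite (leq_trans (count_size _ _))// size_map.
Qed.

Lemma adj_step (u v : int * int) :
  adj u v -> exists2 d, d \in steps & v = (u.1 + d.1, u.2 + d.2)%R.
Proof.
case: u v => [x y] [x' y']; rewrite /adj /sqdist/= => /eqP h.
exists (x' - x, y' - y)%R; last by rewrite /= !subrKC.
rewrite !inE !xpair_eqE.
have [hx hy] : (-1 <= x' - x <= 1)%R /\ (-1 <= y' - y <= 1)%R by nia.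
nia.
Qed.

Lemma in_star v (e : E) : (e \in star v) = (v \in val e).
Proof.
have -> : (e \in star v) =
    (val e \in [seq [fset v; (v.1 + d.1, v.2 + d.2)%R] | d <- steps]).
  by rewrite inE; exact: mem_pmap_sub.
apply/idP/idP; first by case/mapP=> d _ ->; rewrite !inE eqxx.
case/edge_other=> u /adj_step[d ds ->] ->.
by apply/mapP; exists d.
Qed.

(** * Edges touching, inside and leaving a finite vertex set *)

Definition touch (C : {fset V}) : {fset E} := \bigcup_(v <- C) star v.

Lemma touchP (C : {fset V}) (e : E) :
  reflect (exists2 v, v \in C & v \in val e) (e \in touch C).
Proof.
apply: (iffP (bigfcupP _ _ _ _)) => [[v /andP[vC _]]|[v vC ve]].
  by rewrite in_star; exists v.
by exists v; rewrite ?vC ?in_star.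
Qed.

Definition inside (C : {fset V}) : {fset E} := [fset e in touch C | val e `<=` C].
Definition bdry (C : {fset V}) : {fset E} := touch C `\` inside C.

Lemma in_inside C (e : E) : (e \in inside C) = (val e `<=` C).
Proof.
rewrite !inE/=; apply/idP/idP => [/andP[]//|sC]; rewrite sC andbT.
have [u [v [_ ve]]] := asboolP _ (valP e).
have ue : u \in val e by rewrite ve !inE eqxx.
by apply/touchP; exists u => //; apply: (fsubsetP sC).
Qed.

Lemma inside2 C (e : E) (u v : V) :
  val e = [fset u; v] -> (e \in inside C) = (u \in C) && (v \in C).
Proof. by rewrite in_inside => ->; rewrite fsubUset !fsub1set. Qed.

Lemma insideS (C C' : {fset V}) : C `<=` C' -> inside C `<=` inside C'.
Proof. by move=> sC; apply/fsubsetP=> e; rewrite !in_inside => /fsubset_trans; apply. Qed.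

Lemma touchS (C C' : {fset V}) : C `<=` C' -> touch C `<=` touch C'.
Proof.
by move=> sC; apply/fsubsetP=> e /touchP[v /(fsubsetP sC) vC ve]; apply/touchP; exists v.
Qed.

Lemma inside_touch (C : {fset V}) : inside C `<=` touch C.
Proof. by apply/fsubsetP=> e; rewrite !inE => /andP[]. Qed.

Lemma bdryP C (e : E) :
  reflect (exists t w, [/\ val e = [fset t; w], t \in C & w \notin C])
  (e \in bdry C).
Proof.
rewrite inE; apply: (iffP andP).
  move=> [ni /touchP[t tC /edge_other[w tw ve]]].
  by exists t, w; split=> //; move: ni; rewrite (inside2 C ve) tC.
move=> [t [w [ve tC wC]]].
rewrite (inside2 C ve) tC; split=> //; apply/touchP.
by exists t => //; apply: edge_endl ve.
Qed.

(** Double counting: each star has at most four edges, and an edge inside [C] lies in two stars of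
    [C]. *)
Lemma card_touch_inside (C : {fset V}) : #|` touch C| + #|` inside C| <= 4 * #|` C|.
Proof.
elim/fset1U_rect: C => [|w X wX IH].
  have -> : touch fset0 = fset0.
    by apply/fsetP=> e; rewrite inE; apply/touchP=> -[v]; rewrite inE.
  have -> : inside fset0 = fset0.
    apply/fsetP=> e; rewrite in_inside inE; apply/negP.
    by have [u [v [_ ->]]] := asboolP _ (valP e); rewrite fsubUset fsub1set inE.
  by rewrite !cardfs0.
have -> : touch (w |` X) = star w `|` touch X.
  apply/fsetP=> e; rewrite inE in_star; apply/touchP/orP => [[v]|[we|/touchP[v vX ve]]].
  - by rewrite !inE => /orP[/eqP->|vX ve]; [left | right; apply/touchP; exists v].
  - by exists w; rewrite // !inE eqxx.
  - by exists v; rewrite // !inE vX orbT.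
(* Only edges at [w] that already touch [X] become inner ones, so each edge of [star w] adds at most
   one to the sum. *)
have : inside (w |` X) `<=` inside X `|` (star w `&` touch X).
  apply/fsubsetP=> e; rewrite !(in_fsetU, in_fsetI) in_star !in_inside => sE.
  case: (boolP (w \in val e)) => we /=.
    have [u wu ve] := edge_other we; apply/orP; right; apply/touchP; exists u.
      move: sE; rewrite ve fsubUset !fsub1set !inE => /andP[_ /orP[/eqP uw|//]].
      by rewrite uw adjxx in wu.
    by rewrite ve !inE eqxx orbT.
  rewrite orbF; apply/fsubsetP=> x xe; have := fsubsetP sE x xe.
  by rewrite !inE => /orP[/eqP xw|//]; rewrite -xw xe in we.
move/fsubset_leq_card => le1; have := leq_card_fsetU (inside X) (star w `&` touch X).
move=> [le2 _]; have := cardfsUI (star w) (touch X); have := card_star w.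
rewrite cardfsU1 wX; lia.
Qed.

Lemma card_bdry (C : {fset V}) : #|` bdry C| + #|` inside C| = #|` touch C|.
Proof.
have := cardfsID (inside C) (touch C).
by rewrite (fsetIidPr (inside_touch C)) addnC.
Qed.

Lemma inside_add1 (X : {fset V}) (u w : V) : w \notin X -> u \in X -> adj u w ->
  #|` inside X| < #|` inside (w |` X)|.
Proof.
move=> wX uX /adj_edge[e ve]; apply: (@ltn_card_fset _ _ _ e).
- exact/insideS/fsubsetUr.
- by rewrite (inside2 _ ve) !inE uX eqxx orbT.
- by rewrite (inside2 _ ve) (negbTE wX) andbF.
Qed.

Lemma inside_add2 (X : {fset V}) (u u' w : V) :
  w \notin X -> u \in X -> u' \in X -> u != u' -> adj u w -> adj u' w -> (#|` inside X|).+1 < #|` inside (w |` X)|.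
Proof.
move=> wX uX uX' nuu /adj_edge[e ve] /adj_edge[e' ve'].
have eX : e \notin inside X by rewrite (inside2 _ ve) (negbTE wX) andbF.
have eX' : e' \notin inside X by rewrite (inside2 _ ve') (negbTE wX) andbF.
have nee : e != e'.
  apply: contra nuu => /eqP ee; have : u \in val e' by rewrite -ee (edge_endl ve).
  by rewrite ve' !inE => /orP[//|/eqP uw]; rewrite -uw uX in wX.
have : e |` (e' |` inside X) `<=` inside (w |` X).
  rewrite !fsubUset !fsub1set (inside2 _ ve) (inside2 _ ve') !inE uX uX' eqxx !orbT/=.
  by apply/insideS/fsubsetUr.
by move/fsubset_leq_card; rewrite !cardfsU1 in_fset1U negb_or nee eX eX' addnA.
Qed.

(** * The component of [v0] spanned by a finite edge set *)

Definition linked (S : {fset E}) (u v : V) : Prop :=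
  exists2 e, e \in S & val e = [fset u; v].

(** A reachable vertex is [v0] or an end of an edge of [S]; restricting to these makes the component
    a finite set. *)
Definition comp (v0 : V) (S : {fset E}) : {fset V} :=
  [fset v in v0 |` \bigcup_(e <- S) val e | `[< clos_refl_trans V (linked S) v0 v >]].

Lemma compP v0 (S : {fset E}) v :
  reflect (clos_refl_trans V (linked S) v0 v) (v \in comp v0 S).
Proof.
rewrite inE; apply: (iffP andP) => [[_ /asboolP//]|cv].
split; last exact/asboolP.
case/clos_rt_rtn1_iff: cv => [|u w [e eS ve] _]; first by rewrite !inE eqxx.
rewrite !inE; apply/orP; right; apply/bigfcupP; exists e; first by rewrite eS.
exact: edge_endr ve.
Qed.

Lemma comp0 v0 S : v0 \in comp v0 S.
Proof. by apply/compP; apply: rt_refl. Qed.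

Lemma comp_closed v0 S (e : E) u v :
  e \in S -> val e = [fset u; v] -> u \in comp v0 S -> v \in comp v0 S.
Proof.
move=> eS ve /compP cu; apply/compP; apply: rt_trans cu _.
by apply: rt_step; exists e.
Qed.

Lemma comp_sub v0 S (X : {fset V}) : v0 \in X ->
  (forall (e : E) t w, e \in S -> val e = [fset t; w] ->
     t \in comp v0 S -> t \in X -> w \in X) ->
  comp v0 S `<=` X.
Proof.
move=> v0X stepX; apply/fsubsetP=> v /compP/clos_rt_rtn1_iff.
elim=> // u w [e eS ve] cu uX; apply: stepX eS ve _ uX.
by apply/compP/clos_rt_rtn1_iff.
Qed.

Lemma comp_escape v0 S (X : {fset V}) : v0 \in X -> ~~ (comp v0 S `<=` X) ->
  exists (e : E) t w,
    [/\ e \in S, val e = [fset t; w], t \in X, w \in comp v0 S & w \notin X].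
Proof.
move=> v0X /negP nsub; apply: contrapT => none; apply: nsub.
apply: comp_sub => // e t w eS ve tC tX; apply: contrapT => /negP wX.
apply: none; exists e, t, w; split=> //; exact: comp_closed eS ve tC.
Qed.

Lemma compS v0 S S' : S `<=` S' -> comp v0 S `<=` comp v0 S'.
Proof.
move=> sS; apply: comp_sub; first exact: comp0.
by move=> e t w /(fsubsetP sS) eS' ve _; apply: comp_closed eS' ve.
Qed.

Lemma comp_ind v0 S (P : {fset V} -> Prop) (X : {fset V}) :
  v0 \in X -> X `<=` comp v0 S -> P X ->
  (forall (Y : {fset V}) (e : E) t w, X `<=` Y -> Y `<=` comp v0 S -> e \in S ->
     val e = [fset t; w] -> t \in Y -> w \notin Y -> P Y -> P (w |` Y)) ->
  P (comp v0 S).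
Proof.
move=> v0X XC PX step.
(* Induction on the number of component vertices still missing from [Y]. *)
suff H n (Y : {fset V}) : #|` comp v0 S `\` Y| <= n -> X `<=` Y ->
    Y `<=` comp v0 S -> P Y -> P (comp v0 S).
  exact: (H _ X (leqnn _)).
elim: n Y => [|n IH] Y.
  rewrite leqn0 cardfs_eq0 fsetD_eq0 => CY _ YC PY.
  by rewrite (_ : comp v0 S = Y)//; apply/eqP; rewrite eqEfsubset CY.
move=> le XY YC PY; case: (boolP (comp v0 S `<=` Y)) => [CY|].
  by rewrite (_ : comp v0 S = Y)//; apply/eqP; rewrite eqEfsubset CY.
case/(comp_escape (fsubsetP XY _ v0X)) => e [t [w [eS ve tY wC wY]]].
apply: (IH (w |` Y)).
- rewrite -ltnS; apply: leq_trans le; apply: (@ltn_card_fset _ _ _ w).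
  + exact/fsetDS/fsubsetUr.
  + by rewrite inE wY.
  + by rewrite !inE eqxx.
- by rewrite (fsubset_trans XY) ?fsubsetUr.
- by rewrite fsubUset fsub1set wC.
- exact: step XY YC eS ve tY wY PY.
Qed.

(** Each vertex added on the way from [X] to the component brings an inner edge, so the number of
    independent cycles does not drop. *)
Lemma card_inside_comp v0 S (X : {fset V}) : v0 \in X -> X `<=` comp v0 S ->
  #|` inside X| + #|` comp v0 S| <= #|` inside (comp v0 S)| + #|` X|.
Proof.
move=> v0X XC; apply: (@comp_ind _ _ (fun Y =>
  #|` inside X| + #|` Y| <= #|` inside Y| + #|` X|) X) => //.
move=> Y e t w _ _ _ ve tY wY; have := inside_add1 wY tY (edge_adj ve).
rewrite cardfsU1 wY /=; lia.
Qed.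

(** Spanning tree: each vertex other than [v0] is first reached by an edge of [S] of its own. *)
Lemma card_comp_safe v0 S : #|` comp v0 S| <= (#|` S `&` inside (comp v0 S)|).+1.
Proof.
apply: (@comp_ind _ _ (fun Y => #|` Y| <= (#|` S `&` inside Y|).+1) [fset v0]).
- exact: fset11.
- by rewrite fsub1set comp0.
- by rewrite cardfs1.
move=> Y e t w _ _ eS ve tY wY le; rewrite cardfsU1 wY add1n ltnS.
apply: leq_trans le _; apply: (@ltn_card_fset _ _ _ e).
- exact/fsetIS/insideS/fsubsetUr.
- by rewrite in_fsetI eS (inside2 _ ve) !inE tY eqxx orbT.
- by rewrite in_fsetI (inside2 _ ve) (negbTE wY) !andbF.
Qed.

(** Adding [w] first brings two inner edges and every later vertex at least one, so a cycle is
    closed. *)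
Lemma card_inside_comp_double v0 S (X : {fset V}) (u u' w : V) :
  v0 \in X -> X `<=` comp v0 S -> w \in comp v0 S -> w \notin X ->
  u \in X -> u' \in X -> u != u' -> adj u w -> adj u' w ->
  #|` inside X| + #|` comp v0 S| < #|` inside (comp v0 S)| + #|` X|.
Proof.
move=> v0X XC wC wX uX uX' nu uw uw'; have lt := inside_add2 wX uX uX' nu uw uw'.
have := @card_inside_comp v0 S (w |` X); rewrite !inE v0X orbT cardfsU1 wX.
rewrite fsubUset fsub1set wC => /(_ isT XC); lia.
Qed.

(** * Bad and fair edges, and the effect of Maker's move on them *)

Definition bad (C : {fset V}) (e : E) : Prop :=
  forall w, w \in val e -> w \notin C ->
  exists u u', [/\ u \in C, u' \in C, u != u', adj u w & adj u' w].

(** The third case records only the path [s], [z], [w] avoiding [t]; adjacency of [s] and [t] is not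
    asked for. *)
Definition fair v0 (C : {fset V}) (e : E) : Prop :=
  [\/ bad C e, v0 \in val e |
      exists (t w s z : V), [/\ val e = [fset t; w], t \in C & s \in C] /\
        [/\ adj s z, adj z w & z != t]].

Lemma bad_mono (C C' : {fset V}) e : C `<=` C' -> bad C e -> bad C' e.
Proof.
move=> /fsubsetP sC bd w we wC'; have wC : w \notin C by apply: contra wC'; apply: sC.
by have [u [u' [/sC uC /sC uC' nu uw uw']]] := bd w we wC; exists u, u'.
Qed.

Lemma fair_mono v0 (C C' : {fset V}) e : C `<=` C' -> fair v0 C e -> fair v0 C' e.
Proof.
move=> sC [/(bad_mono sC)|v0e|[t [w [s [z [[ve tC sC'] sz]]]]]].
- by constructor 1.
- by constructor 2.
- by constructor 3; exists t, w, s, z; split=> //; split=> //; apply: (fsubsetP sC).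
Qed.

Definition free (C : {fset V}) (D : {fset E}) : {fset E} := bdry C `\` D.
Definition free_bad C D : {fset E} := [fset e in free C D | `[< bad C e >]].
Definition free_unfair v0 C D : {fset E} := [fset e in free C D | ~~ `[< fair v0 C e >]].
Definition degree_in v0 (C : {fset V}) := #|` star v0 `&` inside C|.

Lemma in_free_bad C D e : reflect (e \in free C D /\ bad C e) (e \in free_bad C D).
Proof.
rewrite /free_bad; move: (free C D) => F; rewrite inE.
apply: (iffP andP) => [[eF /asboolP]|[eF] eP] //.
by split=> //; apply/asboolP.
Qed.

Lemma in_free_unfair v0 C D e :
  reflect (e \in free C D /\ ~ fair v0 C e) (e \in free_unfair v0 C D).
Proof.
rewrite /free_unfair; move: (free C D) => F; rewrite inE.
apply: (iffP andP) => [[eF /asboolP]|[eF] eP] //.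
by split=> //; apply/asboolP.
Qed.

Lemma bdry_notin (C : {fset V}) (e : E) (t w : V) :
  e \in bdry C -> val e = [fset t; w] -> t \in C -> w \notin C.
Proof. by rewrite inE => /andP[+ _] ve tC; rewrite (inside2 _ ve) tC. Qed.

Lemma mem_bdry (C : {fset V}) (e : E) (t w : V) :
  val e = [fset t; w] -> t \in C -> w \notin C -> e \in bdry C.
Proof. by move=> ve tC wC; apply/bdryP; exists t, w. Qed.

(** Maker leaves [C] by a free, hence fair, edge. Unless a cycle is closed, that edge is not bad; it
    then either meets [v0] or makes a turn, which yields a new bad edge. *)
Lemma growth_step v0 (S S' D : {fset E}) (C := comp v0 S) (C' := comp v0 S') :
    S `<=` S' -> D `<=` touch C -> [disjoint S' & D] ->
    (forall e, e \in free C D -> fair v0 C e) -> C != C' ->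
  [\/ #|` inside C| + #|` C'| < #|` inside C'| + #|` C|,
      degree_in v0 C < degree_in v0 C' |
      #|` free_bad C D| < #|` free_bad C' D| /\ ~~ (free C D `<=` free_bad C D)].
Proof.
move=> sS DC dS allfair neqC.
have v0C : v0 \in C := comp0 v0 S.
have CC' : C `<=` C' := compS v0 sS.
have [lt|le] := ltnP (#|` inside C| + #|` C'|) (#|` inside C'| + #|` C|).
  by constructor 1.
have noDouble w u u' : w \in C' -> w \notin C -> u \in C -> u' \in C -> u != u' ->
    adj u w -> adj u' w -> False.
  move=> wC' wC uC uC' nu uw uw'.
  by have := card_inside_comp_double v0C CC' wC' wC uC uC' nu uw uw'; rewrite ltnNge le.
have nsub : ~~ (C' `<=` C) by apply: contra neqC => sub; rewrite eqEfsubset CC'.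
have [e [t [w [eS' ve tC wC' wC]]]] := comp_escape v0C nsub.
have eB : e \in bdry C := mem_bdry ve tC wC.
have eF : e \in free C D by rewrite in_fsetD eB (fdisjointP dS _ eS').
have nbad : ~ bad C e.
  move=> /(_ w (edge_endr ve) wC)[u [u' [uC uC' nu uw uw']]].
  exact: noDouble wC' wC uC uC' nu uw uw'.
case: (allfair e eF) => // [v0e|[t1 [w1 [s [z [[ve1 tC1 sC] [sz zw1 nzt1]]]]]]].
  constructor 2; apply: (@ltn_card_fset _ _ _ e).
  - exact/fsetIS/insideS.
  - by rewrite in_fsetI in_star v0e (inside2 _ ve) wC' (fsubsetP CC').
  - by rewrite in_fsetI (inside2 _ ve) (negbTE wC) !andbF.
have wC1 : w1 \notin C := bdry_notin eB ve1 tC1.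
have wC1' : w1 \in C' by apply: comp_closed eS' ve1 _; apply: (fsubsetP CC').
have zC : z \notin C.
  by apply/negP => zC; apply: (noDouble w1 z t1) => //; apply: edge_adj ve1.
have nsw : s != w1 by apply: contraNneq wC1 => <-.
(* Once [w1] is added, [z] has the two neighbours [s] and [w1]; reaching it would close a cycle. *)
have zC' : z \notin C'.
  apply/negP => zC'; suff : #|` inside C| + #|` C'| < #|` inside C'| + #|` C|.
    by rewrite ltnNge le.
  have lt1 := inside_add1 wC1 tC1 (edge_adj ve1).
  have nzw : z != w1 by apply: contraTneq zw1 => ->; rewrite adjxx.
  have sub : w1 |` C `<=` C' by rewrite fsubUset fsub1set wC1'.
  have v0X : v0 \in w1 |` C by rewrite in_fset1U v0C orbT.
  have sX : s \in w1 |` C by rewrite in_fset1U sC orbT.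
  have := @card_inside_comp_double v0 S' _ s w1 z v0X sub zC' _ sX (fset1U1 _ _) nsw sz.
  rewrite in_fset1U negb_or nzw zC (adj_sym w1) zw1 cardfsU1 wC1 => /(_ isT isT).
  rewrite -/C'; move: lt1.
  move: #|` inside C| #|` inside (w1 |` C)| #|` inside C'| #|` C| #|` C'|.
  by clear; lia.
(* This is the new bad edge: its outer end [z] is adjacent to [s] and to [w1], both now in [C']. *)
have [e2 ve2] := adj_edge zw1.
have e2C : e2 \notin touch C.
  by apply/touchP => -[v vC]; rewrite ve2 !inE => /orP[]/eqP vE;
    rewrite vE ?(negbTE zC) ?(negbTE wC1) in vC.
constructor 3; split; last first.
  by apply/negP => /fsubsetP/(_ e eF)/in_free_bad[].
apply: (@ltn_card_fset _ _ _ e2).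
(* Old bad edges stay free, since reaching their outer ends would close a cycle. *)
- apply/fsubsetP => e0 /in_free_bad[]; rewrite in_fsetD => /andP[e0D e0B] bd.
  apply/in_free_bad; split; last exact: bad_mono bd.
  rewrite in_fsetD e0D; have /bdryP[t0 [w0 [ve0 tC0 wC0]]] := e0B.
  apply: (mem_bdry ve0); first exact: (fsubsetP CC').
  apply/negP => wC0'; have [u [u' [uC uC' nu uw uw']]] := bd w0 (edge_endr ve0) wC0.
  exact: noDouble wC0' wC0 uC uC' nu uw uw'.
- apply/in_free_bad; split.
    rewrite in_fsetD (contra _ e2C) /=; last exact: (fsubsetP DC).
    by apply: (mem_bdry _ wC1' zC'); rewrite ve2 fsetUC.
  move=> w2; rewrite ve2 in_fset2 => /orP[]/eqP->; last by rewrite wC1'.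
  by move=> _; exists s, w1; rewrite adj_sym in zw1; split=> //; apply: (fsubsetP CC').
- apply/negP => /in_free_bad[]; rewrite !in_fsetD (negbTE e2C) !andbF//.
Qed.

(** Fairness survives growth, so an unfair edge starts at a new vertex; a new vertex has at most
    one, the straight continuation. Hence the inner end determines the edge. *)
Lemma card_free_unfair v0 (S S' D : {fset E}) (C := comp v0 S) (C' := comp v0 S') :
  S `<=` S' -> (forall e, e \in free C D -> fair v0 C e) ->
  #|` free_unfair v0 C' D| <= #|` C'| - #|` C|.
Proof.
move=> sS allfair; have CC' : C `<=` C' := compS v0 sS.
rewrite -cardfsDS//.
have ends e : e \in free_unfair v0 C' D ->
    exists t, t \in C' `\` C /\ exists w, val e = [fset t; w] /\ w \notin C'.
  case/in_free_unfair; rewrite in_fsetD => /andP[eD /bdryP[t [w [ve tC' wC']]]] nf.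
  exists t; split; last by exists w.
  rewrite in_fsetD tC' andbT; apply/negP => tC; apply: nf; apply: (fair_mono CC').
  apply: allfair; rewrite in_fsetD eD; apply: (mem_bdry ve tC).
  by apply: contra wC'; apply: (fsubsetP CC').
pose g (e : E) := xget v0 (fun t => (t \in C' `\` C)%fset /\
  exists w, val e = [fset t; w]%fset /\ w \notin C').
have gP e : e \in free_unfair v0 C' D -> g e \in C' `\` C /\
    exists w, val e = [fset g e; w] /\ w \notin C'.
  by move=> /ends[t tP]; rewrite /g; case: xgetP => [? _ //|/(_ t)].
suff inj : {in free_unfair v0 C' D &, injective g}.
  rewrite -(card_in_imfset imfset_key inj); apply: fsubset_leq_card.
  by apply/fsubsetP => _ /imfsetP[e /= eU ->]; have [] := gP _ eU.
(* A vertex [t] of [C'] has a neighbour [s] in [C']; the outer end of an unfair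
   edge at [t] can only be the point opposite to [s]. *)
have opposite e t w s : e \in free_unfair v0 C' D -> val e = [fset t; w] ->
    t \in C' -> w \notin C' -> s \in C' -> adj t s ->
    w = (t.1 + t.1 - s.1, t.2 + t.2 - s.2)%R.
  move=> /in_free_unfair[_ nf] ve tC' wC' sC' ts; apply: contrapT => now; apply: nf.
  (* The fourth corner of the parallelogram on [s], [t], [w]; it equals [t] only if [w] is opposite
     to [s]. *)
  constructor 3; exists t, w, s, (s.1 + w.1 - t.1, s.2 + w.2 - t.2)%R.
  split; split=> //.
  - have := edge_adj ve; rewrite /adj /sqdist /= => /eqP<-; apply/eqP; ring.
  - move: ts; rewrite /adj /sqdist /= => /eqP<-; apply/eqP; ring.
  - apply/eqP => tE; apply: now.
    case: t w s tE {ve tC' wC' sC' ts} => [t1 t2] [w1 w2] [s1 s2].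
    by move=> /= [? ?]; congr (_, _); lia.
have nbr t : t \in C' -> t != v0 -> exists2 s, s \in C' & adj t s.
  move=> /compP/clos_rt_rtn1_iff; case=> [|s t' [e eS ve] cs]; first by rewrite eqxx.
  move=> _; exists s; first by apply/compP/clos_rt_rtn1_iff.
  by rewrite adj_sym (edge_adj ve).
move=> e1 e2 e1U e2U eqg.
have [gC [w1 [ve1 wC1]]] := gP _ e1U; have [_ [w2 [ve2 wC2]]] := gP _ e2U.
rewrite -eqg in ve2; move: gC; rewrite in_fsetD => /andP[_ gC].
have [s sC gs] : exists2 s, s \in C' & adj (g e1) s.
  apply: nbr gC _; apply/eqP => g0; have /in_free_unfair[_] := e1U; apply.
  by constructor 2; rewrite ve1 g0 !inE eqxx.
apply: val_inj; rewrite ve1 ve2.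
by rewrite (opposite _ _ _ _ e1U ve1 gC wC1 sC gs)
  (opposite _ _ _ _ e2U ve2 gC wC2 sC gs).
Qed.

(** * Breaker's reply *)

Lemma fset_between (T : choiceType) (A B : {fset T}) k :
  A `<=` B -> #|` A| <= k <= #|` B| ->
  exists X : {fset T}, [/\ A `<=` X, X `<=` B & #|` X| = k].
Proof.
move=> AB /andP[]; elim: k => [|k IH].
  by rewrite leqn0 => /eqP A0 _; exists A; split.
rewrite leq_eqVlt => /orP[/eqP <- _|Ak kB]; first by exists A; split.
have [X [AX XB Xk]] := IH Ak (ltnW kB).
have : ~~ (B `<=` X) by apply: contraTN kB => /fsubset_leq_card; rewrite Xk -leqNgt.
move=> /fsubsetPn[x xB xX]; exists (x |` X); split.
- exact: fsubset_trans AX (fsubsetUr _ _).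
- by rewrite fsubUset fsub1set xB.
- by rewrite cardfsU1 xX Xk.
Qed.

Lemma fresh_edge (F : {fset E}) : exists e : E, e \notin F.
Proof.
pose X : {fset V} := \bigcup_(e <- F) val e.
have [v vX] : exists v : V, v \notin X.
  apply: contrapT => none; have [inf _] := Z2_infinite_connected; apply: inf.
  apply: sub_finite_set (finite_fset X) => v _ /=; apply: contrapT => /negP vX.
  by apply: none; exists v.
have [e ve] : exists e : E, val e = [fset v; (v.1 + 1, v.2)%R].
  by apply: adj_edge; rewrite /adj /sqdist /=; apply/eqP; ring.
exists e; apply: contra vX => eF; apply/bigfcupP; exists e; first by rewrite eF.
exact: edge_endl ve.
Qed.

(** Fills up Breaker's move when fewer than [q] free edges are left. *)
Lemma fresh_edges (F : {fset E}) k :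
  exists2 X : {fset E}, #|` X| = k & [disjoint X & F].
Proof.
elim: k => [|k [X Xk XF]]; first by exists fset0; rewrite ?cardfs0 ?fdisjoint0X.
have [e] := fresh_edge (X `|` F); rewrite in_fsetU negb_or => /andP[eX eF].
by exists (e |` X); rewrite ?cardfsU1 ?eX ?Xk// fdisjointU1X eF.
Qed.

(** A safe edge cannot leave the component, so free edges are unsafe and open to deletion. *)
Lemma free_disjoint v0 S D : [disjoint free (comp v0 S) D & S `|` D].
Proof.
apply/fdisjointP => e; rewrite in_fsetD => /andP[eD eB].
rewrite in_fsetU negb_or eD andbT; apply/negP => eS.
move/bdryP: eB => [t [w [ve tC wC]]].
by have := comp_closed eS ve tC; rewrite (negbTE wC).
Qed.

(** Either Breaker encloses the component, or the last two clauses encode his priorities: unfair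
    edges first, bad edges last. *)
Definition good_reply v0 q (S D b : {fset E}) (C := comp v0 S) : Prop :=
  [/\ #|` b| = q, [disjoint b & S `|` D] &
   free C D `<=` b \/
   [/\ b `<=` free C D,
       b `<=` free_unfair v0 C D \/ free_unfair v0 C D `<=` b &
       [disjoint b & free_bad C D] \/ free C D `\` b `<=` free_bad C D]].

Lemma good_reply_exists v0 q S D : exists b, good_reply v0 q S D b.
Proof.
pose F := free (comp v0 S) D.
have dF : [disjoint F & S `|` D] := free_disjoint v0 S D.
case: (leqP #|` F| q) => [le|lt].
  have [X Xk] := fresh_edges (F `|` (S `|` D)) (q - #|` F|).
  rewrite fdisjointXU => /andP[XF XSD]; exists (F `|` X); split.
  - by rewrite cardfsU fsetIC (disjoint_fsetI0 XF) cardfs0 Xk subn0 subnKC.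
  - by rewrite fdisjointUX dF.
  - by left; apply: fsubsetUl.
have bF : free_bad (comp v0 S) D `<=` F by apply/fsubsetP => e /in_free_bad[].
pose U := free_unfair v0 (comp v0 S) D; pose N := F `\` free_bad (comp v0 S) D.
have UN : U `<=` N.
  apply/fsubsetP => e /in_free_unfair[eF nf]; rewrite in_fsetD eF andbT.
  by apply/negP => /in_free_bad[_ bd]; apply: nf; constructor 1.
have NF : N `<=` F by apply: fsubsetDl.
(* Bad edges are fair, so [U], [N], [F] form a chain; a [q]-set comparable with all three obeys both
   priorities. *)
suff [b [bF' bq bU bN]] : exists b : {fset E}, [/\ b `<=` F, #|` b| = q,
    b `<=` U \/ U `<=` b & b `<=` N \/ N `<=` b].
  exists b; split=> //; first exact: fdisjointWl bF' dF.
  right; split=> //; case: bN => [bN|Nb]; [left|right].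
    by apply: fdisjointWl bN _; apply/fdisjointP => e; rewrite in_fsetD => /andP[].
  apply/fsubsetP => e; rewrite in_fsetD => /andP[eb eF]; apply: contraNT eb => eB.
  by apply: (fsubsetP Nb); rewrite in_fsetD eB.
case: (leqP q #|` U|) => [qU|/ltnW Uq].
  have [|b [_ bU bq]] := @fset_between _ fset0 U q (fsub0set _); first by rewrite cardfs0.
  exists b; split=> //; [|by left|left]; last exact: fsubset_trans bU UN.
  exact: fsubset_trans bU (fsubset_trans UN NF).
case: (leqP q #|` N|) => [qN|/ltnW Nq].
  have [|b [Ub bN bq]] := @fset_between _ U N q UN; first by rewrite Uq.
  by exists b; split=> //; [exact: fsubset_trans bN NF|right|left].
have [|b [Nb bF' bq]] := @fset_between _ N F q NF; first by rewrite Nq ltnW.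
by exists b; split=> //; right=> //; apply: fsubset_trans UN Nb.
Qed.

(** * Edge count and progress measure *)

(** By double counting, [#bdry + 2 #inside <= 4 #C]. One of the two [#inside] is at least the
    deleted inner edges plus the [#C - 1] edges of a safe spanning tree; the remaining deleted edges
    lie in the boundary. *)
Lemma card_free_le v0 S D (C := comp v0 S) : D `<=` touch C -> [disjoint S & D] ->
  #|` free C D| + #|` inside C| + #|` D| <= (3 * #|` C|).+1.
Proof.
move=> DT dS; have le4 := card_touch_inside C; have eB := card_bdry C.
have eF := cardfsID D (bdry C); have leC := card_comp_safe v0 S.
have eD : #|` D `&` inside C| + #|` bdry C `&` D| = #|` D|.
  rewrite -(cardfsID (inside C) D); congr (_ + #|` _|).
  apply/fsetP => e; rewrite !(in_fsetI, in_fsetD).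
  by case: (boolP (e \in D)) => [/(fsubsetP DT)->|]; rewrite ?andbT ?andbF.
have leI : #|` D `&` inside C| + #|` S `&` inside C| <= #|` inside C|.
  rewrite -cardfsUI -fsetIIl [D `&` S]fsetIC (disjoint_fsetI0 dS) fset0I cardfs0 addn0.
  by apply: fsubset_leq_card; rewrite fsubUset !fsubsetIr.
rewrite -/C in leC; rewrite /free.
move: le4 eB eF leC eD leI.
move: #|` inside C| #|` touch C| #|` bdry C| #|` C| #|` bdry C `&` D|.
move: #|` bdry C `\` D| #|` S `&` inside C| #|` D `&` inside C| #|` D|.
by clear; lia.
Qed.

(** The value [5] exceeds any count of at most four free edges. It is taken when all free edges are
    bad: Breaker may then have to delete bad ones, but any growth closes a cycle. *)
Definition bad_rank C D :=
  if free C D `<=` free_bad C D then 5 else #|` free_bad C D|.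

(* [#|` inside C|.+1 - #|` C|] is the number of independent cycles of the
   subgraph induced by [C]. *)
Definition progress v0 C D :=
  6 * ((#|` inside C|).+1 - #|` C| + degree_in v0 C) + bad_rank C D.

Lemma free_bad_sub C D : free_bad C D `<=` free C D.
Proof. by apply/fsubsetP => e /in_free_bad[]. Qed.

Lemma bad_rank_le5 C D : #|` free C D| <= 4 -> bad_rank C D <= 5.
Proof.
rewrite /bad_rank => F4; case: ifP => // _.
by apply: leq_trans (fsubset_leq_card (free_bad_sub _ _)) _; apply: leq_trans F4 _.
Qed.

Lemma free_badU C D b : free_bad C (D `|` b) = free_bad C D `\` b.
Proof.
apply/fsetP => e; rewrite in_fsetD; apply/in_free_bad/andP.
  by rewrite /free -fsetDDl in_fsetD => -[/andP[eb eF] bd]; split=> //; apply/in_free_bad.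
by move=> [eb /in_free_bad[eF bd]]; rewrite /free -fsetDDl in_fsetD eb.
Qed.

(** Cycle number and degree never drop, and a rise in either, weighted by 6, outweighs a loss of at
    most 5 in [bad_rank]. If neither rises, [bad_rank] does not drop, and it rises when the
    component grows. *)
Lemma progress_step v0 (S S' D b : {fset E}) (C := comp v0 S) (C' := comp v0 S') :
    S `<=` S' -> D `<=` touch C -> [disjoint S' & D] ->
    (forall e, e \in free C D -> fair v0 C e) -> #|` free C D| <= 4 ->
    [disjoint b & free_bad C' D] \/ free C' D `\` b `<=` free_bad C' D ->
  progress v0 C D + (C != C') <= progress v0 C' (D `|` b).
Proof.
move=> sS DT dS allfair F4 hb.
have CC' : C `<=` C' := compS v0 sS.
have Fb : free C' (D `|` b) = free C' D `\` b by rewrite /free fsetDDl.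
have le5 := bad_rank_le5 F4.
(* After the reply, either all free edges are bad and the rank is 5, or no bad edge was deleted. *)
have hb' : free C' (D `|` b) `<=` free_bad C' (D `|` b) \/
    ~~ (free C' D `<=` free_bad C' D) /\ free_bad C' (D `|` b) = free_bad C' D.
  rewrite Fb free_badU.
  have [full|nfull] := boolP (free C' D `<=` free_bad C' D); first by left; apply: fsetSD.
  case: hb => [dis|sub]; [right; split=> //|left].
    by apply/fsetDidPl; rewrite fdisjoint_sym.
  apply/fsubsetP => e eF; rewrite in_fsetD (fsubsetP sub)// andbT.
  by move: eF; rewrite in_fsetD => /andP[].
(* Ensures that the subtraction in [progress] is not truncated. *)
have leI : #|` C| <= (#|` inside C|).+1.
  apply: leq_trans (card_comp_safe v0 S) _.
  by rewrite ltnS fsubset_leq_card ?fsubsetIr.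
have leI' := @card_inside_comp v0 S' C (comp0 v0 S) CC'.
have led : degree_in v0 C <= degree_in v0 C'.
  by apply: fsubset_leq_card; apply/fsetIS/insideS.
rewrite /progress; case: (eqVneq C C') => [eqC|neqC].
  rewrite addn0 eqC leq_add2l; move: le5; rewrite eqC /bad_rank.
  by case: hb' => [->//|[/negbTE nfull ->]]; rewrite nfull; case: ifP.
rewrite -/C' in leI'.
have grow := growth_step sS DT dS allfair neqC; rewrite -/C -/C' in grow.
have [lt|[lt|lt]] : #|` inside C| + #|` C'| < #|` inside C'| + #|` C| \/
    degree_in v0 C < degree_in v0 C' \/ bad_rank C D < bad_rank C' (D `|` b).
  case: grow => [lt|lt|[ltB /negbTE nfull]]; [by left|by right; left|right; right].
  have leB : #|` free_bad C D| < 5.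
    by rewrite ltnS (leq_trans (fsubset_leq_card (free_bad_sub _ _))).
  by rewrite /bad_rank nfull; case: hb' => [->//|[_ ->]]; case: ifP.
all: move: lt le5 leI leI' led; move: (bad_rank _ _) (bad_rank _ _).
all: move: #|` inside C| #|` inside C'| #|` C| #|` C'|.
all: by move: (degree_in _ _) (degree_in _ _); clear; lia.
Qed.

(** * The invariant of the play and its termination *)

Record play_inv (p q : nat) v0 t (S D : {fset E}) (C := comp v0 S) : Prop := PlayInv {
  inv_safe : #|` S| = p * t;
  inv_deleted : #|` D| = q * t;
  inv_disjoint : [disjoint S & D];
  inv_touch : D `<=` touch C;
  inv_fair : forall e, e \in free C D -> fair v0 C e }.

Lemma play_inv0 p q v0 : play_inv p q v0 0 fset0 fset0.
Proof.
have C0 v : v \in comp v0 fset0 -> v = v0.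
  by move=> /compP/clos_rt_rtn1_iff; case=> // ? ? [].
split; rewrite ?cardfs0 ?muln0 ?fsub0set ?fdisjoint0X//.
move=> e; rewrite in_fsetD => /andP[_ /bdryP[t [w [ve /C0 tC _]]]].
by constructor 2; rewrite ve tC !inE eqxx.
Qed.

(** With [n] the size of [C], [card_free_le] gives [#free + #inside + 2 p t <= 3 n + 1]; combine it
    with [#free >= 1] and [n - 1 <= #inside], and with [n <= p t + 1]. *)
Lemma play_inv_bounds p q v0 t S D (C := comp v0 S) :
  2 * p <= q -> play_inv p q v0 t S D -> 0 < #|` free C D| ->
  [/\ p * t <= #|` C|, #|` C| <= (p * t).+1, #|` free C D| <= 4 &
      (#|` inside C|).+1 - #|` C| <= 3].
Proof.
move=> le_2p_q [cS cD dSD DT _] F0; have le := card_free_le DT dSD.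
have leS : #|` C| <= (#|` S|).+1.
  apply: leq_trans (card_comp_safe v0 S) _.
  by rewrite ltnS fsubset_leq_card ?fsubsetIl.
have leI : #|` C| <= (#|` inside C|).+1.
  apply: leq_trans (card_comp_safe v0 S) _.
  by rewrite ltnS fsubset_leq_card ?fsubsetIr.
have le2 : 2 * (p * t) <= q * t by rewrite mulnA leq_mul2r le_2p_q orbT.
move: le F0 leS leI le2; rewrite cS cD -/C.
move: #|` free C D| #|` inside C| #|` C| (p * t) (q * t).
by clear; move=> f i c x y ? ? ? ? ?; split; lia.
Qed.

Lemma play_inv_step p q v0 t S D M B (C := comp v0 S) (S' := S `|` M) (D' := D `|` B)
    (C' := comp v0 S') :
  0 < p -> 2 * p <= q ->
  play_inv p q v0 t S D -> 0 < #|` free C D| -> 0 < #|` free C' D'| ->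
  #|` M| = p -> [disjoint M & S `|` D] -> good_reply v0 q S' D B ->
  play_inv p q v0 t.+1 S' D' /\ progress v0 C D + (C != C') <= progress v0 C' D'.
Proof.
move=> p_gt0 le_2p_q inv F0 F0' cM; rewrite fdisjointXU => /andP[MS MD] [cB dB reply].
have [lo _ F4 _] := play_inv_bounds le_2p_q inv F0; case: inv => cS cD dSD DT allfair.
have sS : S `<=` S' by apply: fsubsetUl.
have FE : free C' D' = free C' D `\` B by rewrite /free fsetDDl.
have dS'D : [disjoint S' & D] by rewrite fdisjointUX dSD.
have cS' : #|` S'| = p * t.+1.
  by rewrite cardfsU fsetIC (disjoint_fsetI0 MS) cardfs0 subn0 cS cM mulnS addnC.
move: dB; rewrite fdisjointXU => /andP[BS' BD].
(* Deleting all free edges contradicts [F0'], so the reply follows the priorities. *)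
case: reply => [sub|[BF prioU prioB]].
  by move: sub F0'; rewrite FE -fsetD_eq0 => /eqP ->; rewrite cardfs0.
split; last exact: progress_step.
split.
- exact: cS'.
- by rewrite cardfsU fsetIC (disjoint_fsetI0 BD) cardfs0 subn0 cD cB mulnS addnC.
- by rewrite fdisjointXU dS'D fdisjoint_sym.
- rewrite fsubUset (fsubset_trans DT) ?touchS ?compS//=.
  by apply: fsubset_trans BF _; apply: fsubset_trans (fsubsetDl _ _) (fsubsetDl _ _).
(* Fewer unfair edges than deletions: at most one for each of the at most
   [p + 1] vertices that Maker's move has added to the component. *)
have leU : #|` free_unfair v0 C' D| <= #|` B|.
  apply: leq_trans (card_free_unfair sS allfair) _.
  have : #|` C'| <= (#|` S'|).+1.
    apply: leq_trans (card_comp_safe v0 S') _.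
    by rewrite ltnS fsubset_leq_card ?fsubsetIl.
  rewrite -/C' -/C cS' cB mulnS; move: lo p_gt0 le_2p_q; rewrite -/C.
  by move: #|` C| #|` C'| (p * t) => c c' x; clear; lia.
have UB : free_unfair v0 C' D `<=` B.
  case: prioU => // BU; suff -> : B = free_unfair v0 C' D by [].
  by apply/eqP; rewrite eqEfcard BU.
move=> e; rewrite -/C' FE in_fsetD => /andP[eB eF].
apply: contrapT => nf; move/negP: eB; apply; apply: (fsubsetP UB).
exact/in_free_unfair.
Qed.

Lemma enclosed_eventually p q v0 (S D M B : nat -> {fset E}) :
  0 < p -> 2 * p <= q ->
  S 0 = fset0 -> D 0 = fset0 ->
  (forall t, S t.+1 = S t `|` M t) -> (forall t, D t.+1 = D t `|` B t) ->
  (forall t, #|` M t| = p) -> (forall t, [disjoint M t & S t `|` D t]) ->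
  (forall t, good_reply v0 q (S t.+1) (D t) (B t)) ->
  exists t, free (comp v0 (S t)) (D t) = fset0.
Proof.
move=> p_gt0 le_2p_q S0 D0 SS DS cM dM reply; apply: contrapT => none.
have F0 t : 0 < #|` free (comp v0 (S t)) (D t)|.
  by rewrite lt0n cardfs_eq0; apply/eqP => Ft; apply: none; exists t.
have inv t : play_inv p q v0 t (S t) (D t).
  elim: t => [|t IH]; first by rewrite S0 D0; apply: play_inv0.
  have := F0 t.+1; have := reply t; rewrite SS DS => rep Ft.
  by have [] := play_inv_step p_gt0 le_2p_q IH (F0 t) Ft (cM t) (dM t) rep.
pose mu t := progress v0 (comp v0 (S t)) (D t).
have mu_step t : mu t + (comp v0 (S t) != comp v0 (S t.+1)) <= mu t.+1.
  have := F0 t.+1; have := reply t; rewrite /mu SS DS => rep Ft.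
  by have [] := play_inv_step p_gt0 le_2p_q (inv t) (F0 t) Ft (cM t) (dM t) rep.
have mu_step2 t : mu t < mu t.+2.
  (* The size is at most [p t + 1] at time [t] and at least [p t + 2 p] two rounds later. *)
  have neq : comp v0 (S t) != comp v0 (S t.+2).
    apply/eqP => eqC; have [_ hi _ _] := play_inv_bounds le_2p_q (inv t) (F0 t).
    have [lo _ _ _] := play_inv_bounds le_2p_q (inv t.+2) (F0 t.+2).
    by move: lo hi p_gt0; rewrite -eqC !mulnS; move: #|` _| (p * t); clear; lia.
  have := mu_step t; have := mu_step t.+1.
  have [<-|] := eqVneq (comp v0 (S t)) (comp v0 (S t.+1)).
    by rewrite neq; move: (mu t) (mu t.+1) (mu t.+2); clear; lia.
  by move: (mu t) (mu t.+1) (mu t.+2) (_ != _) => m0 m1 m2 b; clear; lia.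
have mu_ge k : k <= mu k.*2.
  by elim: k => // k IH; rewrite doubleS; apply: leq_ltn_trans IH (mu_step2 _).
(* [47 = 6 * (3 + 4) + 5]: at most three cycles, degree at most four, rank at most five. *)
have : mu 48.*2 <= 47.
  rewrite /mu /progress.
  have [_ _ F4 I3] := play_inv_bounds le_2p_q (inv 48.*2) (F0 48.*2).
  have deg : degree_in v0 (comp v0 (S 48.*2)) <= 4.
    by apply: leq_trans (card_star v0); apply/fsubset_leq_card/fsubsetIl.
  move: deg I3 (bad_rank_le5 F4); move: (degree_in _ _) (_ - _) (bad_rank _ _).
  by clear; lia.
by move=> le; have := leq_trans (mu_ge 48) le.
Qed.

(** * From enclosure to a winning strategy *)

(** An undeleted edge leaving the finite safe component would be free, so the component in the
    undeleted graph lies within it. *)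
Lemma finite_component v0 S D :
  free (comp v0 S) D = fset0 -> finite_set (component (G := Z2) D v0).
Proof.
move=> F0; apply: sub_finite_set (finite_fset (comp v0 S)) => v /= /clos_rt_rtn1_iff.
elim=> [|u w [e eD ve] _ uC]; first exact: comp0.
apply: contrapT => /negP wC; suff : e \in free (comp v0 S) D by rewrite F0.
by rewrite in_fsetD eD; apply: mem_bdry ve uC wC.
Qed.

Theorem theorem1p4 (p q : nat) (p_gt0 : 0 < p) (q_gt0 : 0 < q)
    (le_2p_q : 2 * p <= q) (v0 : vertex Z2) :
  breaker_has_winning_strategy p q v0.
Proof.
(* Good replies exist for arbitrary edge sets, so the choice is defined on every history, legal or
   not. *)
pose sigma : strategy Z2 := fun h m =>
  sval (cid (good_reply_exists v0 q (safe h `|` m) (deleted h))).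
have sigmaP h m : good_reply v0 q (safe h `|` m) (deleted h) (sigma h m) :=
  svalP (cid _).
exists sigma => M B hM hB.
have reply n :
    good_reply v0 q (safe (rounds M B n) `|` M n) (deleted (rounds M B n)) (B n).
  by rewrite hB; apply: sigmaP.
split=> [n|]; first by have [cB dB _] := reply n.
have safeS n : safe (rounds M B n.+1) = safe (rounds M B n) `|` M n.
  by rewrite /safe /rounds mkseqS big_rcons.
have deletedS n : deleted (rounds M B n.+1) = deleted (rounds M B n) `|` B n.
  by rewrite /deleted /rounds mkseqS big_rcons.
have [||n|n|n|n|n|n F0] := @enclosed_eventually p q v0
  (fun n => safe (rounds M B n)) (fun n => deleted (rounds M B n)) M B
  p_gt0 le_2p_q.
- by rewrite /safe /rounds big_nil.
- by rewrite /deleted /rounds big_nil.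
- exact: safeS.
- exact: deletedS.
- by have [] := hM n.
- by have [] := hM n.
- by rewrite safeS; apply: reply.
- by exists n; apply: finite_component F0.
Qed.
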